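(* Let $G$ be a finite simple non-trivial graph with $m$ edges, maximum degree $\Delta$ and minimum degree $\delta$. Then $$GA_1(\mathcal{L}(G))\ge \frac{(2\delta-2)^{1/2}\,\Delta^{3/2}\,\big(M_1(G)-2m\big)^2}{2(\Delta-1)^{3/2}\,\chi_{3/2}(G)}.$$
   Context: A graph is non-trivial if each of its connected components has at least two edges. For a finite simple graph $H$, with $d_u$ the degree of the vertex $u$ in $H$: the first geometric-arithmetic index is $GA_1(H)=\sum_{uv\in E(H)}\frac{2\sqrt{d_u d_v}}{d_u+d_v}$, the first Zagreb index is $M_1(H)=\sum_{u\in V(H)}d_u^2$, and, for $\alpha\in\mathbb{R}$, the general sum-connectivity index is $\chi_{\alpha}(H)=\sum_{uv\in E(H)}(d_u+d_v)^{\alpha}$ (each edge counted once in edge sums). The line graph $\mathcal{L}(G)$ has the edges of $G$ as vertices, two distinct ones being adjacent if and only if they share an endpoint in $G$. *)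

(* Defs.v *)
From HB Require Import structures.
From mathcomp Require Import all_boot all_order all_algebra.
From mathcomp Require Import reals exp.

Set Implicit Arguments.
Unset Strict Implicit.
Unset Printing Implicit Defensive.

Import Order.TTheory GRing.Theory Num.Theory.

Local Open Scope ring_scope.

Record sgraph := SGraph {
  svertex :> finType;
  sedge : rel svertex;
  sedge_sym : symmetric sedge;
  sedge_irr : irreflexive sedge
}.

Section Graph.
Variable G : sgraph.

Definition deg (u : G) : nat := #|[set v | sedge u v]|.

(* The edge uv is the unordered pair {u, v}; sedge is irreflexive, so every
   edge is a set with exactly two elements. *)
Definition edges : {set {set G}} :=
  [set [set x.1; x.2] | x : G * G & sedge x.1 x.2].

Definition max_deg : nat := (\max_(u : G) deg u)%N.

(* If G has a vertex, the default #|G| does not affect the minimum, since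
   deg u < #|G|. *)
Definition min_deg : nat := \big[minn/#|G|]_(u : G) deg u.

Definition components : {set {set G}} :=
  equivalence_partition (connect (@sedge G)) [set: G].

Definition nontrivial : Prop :=
  forall C, C \in components -> (2 <= #|[set A in edges | A \subset C]|)%N.

Definition M1 : nat := (\sum_(u : G) deg u ^ 2)%N.

(* In a sum over A in edges with A = {u, v}, the inner sum and product over A
   are d_u + d_v and d_u d_v. *)
Definition GA1 (R : realType) : R :=
  \sum_(A in edges)
    2 * Num.sqrt (\prod_(u in A) (deg u)%:R) / \sum_(u in A) (deg u)%:R.

Definition chi (R : realType) (alpha : R) : R :=
  \sum_(A in edges) (\sum_(u in A) (deg u)%:R) `^ alpha.

Definition line_vertex : finType := {A : {set G} | A \in edges}.

Definition line_rel : rel line_vertex :=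
  fun A B => (A != B) && (val A :&: val B != set0).

Lemma line_rel_sym : symmetric line_rel.
Proof. by move=> A B; rewrite /line_rel eq_sym setIC. Qed.

Lemma line_rel_irr : irreflexive line_rel.
Proof. by move=> A; rewrite /line_rel eqxx. Qed.

Definition line_graph : sgraph := SGraph line_rel_sym line_rel_irr.

End Graph.

Arguments GA1 : clear implicits.

(* Main.v *)
(** Let L be the line graph of G and k = 2 delta - 2, a lower bound for the
    degrees of L.  If p, q are the square roots of the degrees at the ends of an
    edge of L, then p, q >= sqrt k, so the GA_1 term 2pq/(p^2+q^2) of this edge
    times (p + q)/(2 sqrt k) is at least 1.  Cauchy-Schwarz then bounds |E(L)|^2
    by GA_1(L) times the sum of the terms (p + q)/(2 sqrt k), which by double
    counting is the sum of d^(3/2) over the vertices of L divided by 2 sqrt k.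
    Finally an edge uv of G has degree d_u + d_v - 2 in L, which is at most
    (1 - 1/Delta)(d_u + d_v), and 2|E(L)| = M_1(G) - 2m. *)
Require Import Defs.
From HB Require Import structures.
From mathcomp Require Import all_boot all_order all_algebra.
From mathcomp Require Import reals exp.
From mathcomp Require Import ring lra zify.

Set Implicit Arguments.
Unset Strict Implicit.
Unset Printing Implicit Defensive.

Import Order.TTheory GRing.Theory Num.Theory.

Local Open Scope ring_scope.

(** Cauchy-Schwarz with [1 <= a * b] in place of square roots of [a] and [b], so that it holds over
    any real field. *)
Lemma sqr_card_le_sumM (R : realFieldType) (I : finType) (P : {pred I})
    (a b : I -> R) :
  (forall i, i \in P -> 0 < b i) -> (forall i, i \in P -> 1 <= a i * b i) ->
  #|P|%:R ^+ 2 <= (\sum_(i in P) a i) * \sum_(i in P) b i.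
Proof.
move=> b_gt0 ab_ge1.
set A := \sum_(i in P) a i; set B := \sum_(i in P) b i.
(* Summing a >= 2t - t^2 b; the inequality follows at t = #|P| / B. *)
have tangent t : 2 * t * #|P|%:R - t ^+ 2 * B <= A.
  rewrite mulr_natr -sumr_const /B mulr_sumr -sumrB.
  apply: ler_sum => i Pi; have := ab_ge1 i Pi; have := b_gt0 i Pi.
  move: (a i) (b i) => x y y_gt0 xy_ge1.
  rewrite -(ler_pM2r y_gt0); apply: le_trans xy_ge1.
  (* After multiplication by [y], the claim [(2 * t - t ^+ 2 * y) * y <= 1] is
     [0 <= (1 - t * y) ^+ 2]. *)
  by have := sqr_ge0 (1 - t * y); nra.
have B_ge0 : 0 <= B by apply: sumr_ge0 => i /b_gt0 /ltW.
have [B0|B_neq0] := eqVneq B 0; last first.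
  have B_gt0 : 0 < B by rewrite lt_def B_neq0.
  rewrite -ler_pdivrMr //; apply: le_trans (tangent (#|P|%:R / B)).
  by rewrite le_eqVlt; apply/orP; left; apply/eqP; field.
(* Here [t] would have denominator zero; but a vanishing sum of positive terms is empty. *)
suff -> : #|P| = 0%N by rewrite B0 mulr0 expr0n.
apply: eq_card0 => i; apply/negP => Pi.
have bi0 : b i = 0 by apply: psumr_eq0P B0 _ Pi => j /b_gt0/ltW.
by have := b_gt0 i Pi; rewrite bi0 ltxx.
Qed.

Section Incidence.
Variable G : sgraph.

Lemma sedge_neq (u v : G) : sedge u v -> u != v.
Proof. by apply: contraTneq => ->; rewrite sedge_irr. Qed.

Lemma edgesP (A : {set G}) :
  reflect (exists u v, sedge u v /\ A = [set u; v]) (A \in edges G).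
Proof.
apply: (iffP imsetP) => [[[u v] uv ->]|[u [v [uv ->]]]].
  by exists u, v; split=> //; rewrite inE in uv.
by exists (u, v); rewrite ?inE.
Qed.

Lemma card_edge (A : {set G}) : A \in edges G -> #|A| = 2%N.
Proof. by move=> /edgesP[u [v [/sedge_neq uv ->]]]; rewrite cards2 uv. Qed.

Lemma big_edge (R : Type) (idx : R) (op : Monoid.com_law idx) (F : G -> R)
    (u v : G) :
  sedge u v -> \big[op/idx]_(w in [set u; v]) F w = op (F u) (F v).
Proof. by move=> /sedge_neq uv; rewrite big_setU1 ?inE // big_set1. Qed.

Lemma edges_at (u : G) :
  [set A in edges G | u \in A] = [set [set u; v] | v in [set v | sedge u v]].
Proof.
apply/setP => A; rewrite inE; apply/andP/imsetP.
  case=> /edgesP[a [b [ab ->]]]; rewrite !inE => /orP[]/eqP->.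
    by exists b; rewrite ?inE.
  by exists a; rewrite ?inE 1?sedge_sym // setUC.
case=> v; rewrite inE => uv ->; rewrite !inE eqxx; split=> //.
by apply/edgesP; exists u, v.
Qed.

Lemma set2_inj (u : G) : injective (fun v => [set u; v]).
Proof.
move=> v w /setP eq_vw; move: (eq_vw v) (eq_vw w).
by rewrite !inE !eqxx !orbT => /esym/orP[]/eqP-> // /orP[]/eqP.
Qed.

Lemma card_edges_at (u : G) : #|[set A in edges G | u \in A]| = deg u.
Proof. by rewrite edges_at card_imset //; exact: set2_inj. Qed.

(** Both sides count the pairs of an edge and one of its ends. Values in any [nmodType] let it serve
    for natural and for real weights. *)
Lemma handshake (V : nmodType) (F : G -> V) :
  \sum_(A in edges G) \sum_(u in A) F u = \sum_u F u *+ deg u.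
Proof.
rewrite (exchange_big_dep predT) //=; apply: eq_bigr => u _.
rewrite sumr_const -card_edges_at; congr (_ *+ _).
by apply: eq_card => A; rewrite !inE.
Qed.

Lemma sum_deg : (\sum_(u : G) deg u = 2 * #|edges G|)%N.
Proof.
have -> : (\sum_(u : G) deg u = \sum_(A in edges G) \sum_(u in A) 1)%N.
  by apply/esym/(etrans (handshake (fun=> 1%N))); apply: eq_bigr => u _; lia.
rewrite mulnC -sum_nat_const; apply: eq_bigr => A EA.
by rewrite sum1_card card_edge.
Qed.

Lemma sum_deg_edges : (\sum_(A in edges G) \sum_(u in A) deg u = M1 G)%N.
Proof.
rewrite (handshake (@deg G)); apply: eq_bigr => u _.
by lia.
Qed.

Lemma deg_le_max (u : G) : (deg u <= max_deg G)%N.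
Proof. exact: leq_bigmax. Qed.

Lemma min_deg_le (u : G) : (min_deg G <= deg u)%N.
Proof.
rewrite /min_deg; elim: (index_enum _) (mem_index_enum u) => // v s IHs.
rewrite inE big_cons geq_min => /orP[/eqP->|/IHs->]; first by rewrite leqnn.
by rewrite orbT.
Qed.

(** An isolated vertex would form a component by itself, and a singleton contains no edge. *)
Lemma nontrivial_deg_gt0 : nontrivial G -> forall u : G, (0 < deg u)%N.
Proof.
move=> ntG u; rewrite lt0n; apply/negP => /eqP/cards0_eq no_nbr.
have connect_u v : connect (@sedge G) u v -> v = u.
  case/connectP => [[|w p]] /= => [_ ->|/andP[uw _] _] //.
  by move: (in_set0 w); rewrite -no_nbr inE uw.
pose C := [set v in [set: G] | connect (@sedge G) u v].
have /ntG : C \in components G by apply/imsetP; exists u; rewrite ?inE.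
case/ltnW/card_gt0P => A; rewrite inE => /andP[/edgesP[a [b [ab ->]]]].
move=> /subsetP sub; have := sub a; have := sub b.
rewrite !inE !eqxx orbT => /(_ isT)/connect_u eb /(_ isT)/connect_u ea.
by move: (sedge_neq ab); rewrite ea eb eqxx.
Qed.

Lemma min_deg_gt0 (u0 : G) : nontrivial G -> (0 < min_deg G)%N.
Proof.
move=> ntG; apply: (big_ind (leq 1)) => [|x y x0 y0|u _]; last exact: nontrivial_deg_gt0.
  (* The default value [#|G|] of the minimum is positive because [u0] is a vertex. *)
  by apply/card_gt0P; exists u0.
by rewrite leq_min x0.
Qed.

(** The edges that meet uv are those at u and those at v; only uv is in both sets, and uv is not its
    own neighbour. Inclusion-exclusion thus subtracts 1 twice. The subtraction is never truncated,
    as uv itself counts in both degrees. *)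
Lemma deg_line_graph (A : line_graph G) :
  (deg A = \sum_(u in val A) deg u - 2)%N.
Proof.
have [u [v [uv Auv]]] := edgesP _ (valP A).
pose I w := [set B in edges G | w \in B].
have uv_neq := sedge_neq uv.
have meet : I u :&: I v = [set val A].
  apply/setP => B; rewrite !inE; apply/idP/eqP => [|->]; last first.
    by rewrite (valP A) Auv !inE !eqxx orbT.
  (* An edge through both [u] and [v] contains the set [val A] and has the same size 2. *)
  move=> /andP[/andP[EB uB] /andP[_ vB]]; apply/esym/eqP.
  by rewrite eqEcard (card_edge EB) Auv cards2 uv_neq subUset !sub1set uB vB.
have -> : deg A = #|(I u :|: I v) :\ val A|.
  rewrite /deg -(card_imset _ val_inj); apply: eq_card => B.
  rewrite !inE; apply/imsetP/idP => [[C]|].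
    rewrite !inE /= => /andP[AC meetAC] ->; rewrite (valP C) /=.
    rewrite (inj_eq val_inj) eq_sym AC /=.
    case/set0Pn: meetAC => w; rewrite Auv !inE.
    by case/andP=> /orP[]/eqP-> ->; rewrite ?orbT.
  rewrite -andb_orr => /and3P[BA EB uvB].
  exists (Sub B EB); last by rewrite SubK.
  rewrite inE /= /line_rel -(inj_eq val_inj) SubK eq_sym BA /=.
  by apply/set0Pn; case/orP: uvB => wB; [exists u | exists v];
     rewrite Auv !inE eqxx ?orbT.
have AI : val A \in I u :|: I v by rewrite !inE (valP A) Auv !inE eqxx.
have := cardsD1 (val A) (I u :|: I v); rewrite AI cardsU meet cards1.
rewrite !card_edges_at.
have -> /= : (\sum_(w in val A) deg w = deg u + deg v)%N.
  by rewrite Auv (big_edge addn).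
rewrite add1n; move: #|_ :\ _| => n; lia.
Qed.

End Incidence.

Section GALowerBound.
Variables (R : realType) (G : sgraph).

Lemma GA1_ge0 : 0 <= GA1 G R.
Proof.
apply: sumr_ge0 => A _; apply: divr_ge0; last exact: sumr_ge0.
by rewrite mulr_ge0 // sqrtr_ge0.
Qed.

(** Multiplying the Cauchy-Schwarz bound by four times the root of [k] removes the division and
    turns the number of edges into the degree sum. The intended graph is a line graph. *)
Lemma GA1_lower_bound (k : nat) : (0 < k)%N -> (forall u : G, (k <= deg u)%N) ->
  Num.sqrt k%:R * (\sum_(u : G) (deg u)%:R) ^+ 2
    <= 2 * GA1 G R * \sum_(u : G) (deg u)%:R * Num.sqrt (deg u)%:R.
Proof.
move=> k_gt0 k_le.
set r := Num.sqrt k%:R : R.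
have r_gt0 : 0 < r by rewrite sqrtr_gt0 ltr0n.
pose b (A : {set G}) : R := \sum_(u in A) Num.sqrt (deg u)%:R / (2 * r).
have sumb : \sum_(A in edges G) b A
    = (\sum_(u : G) (deg u)%:R * Num.sqrt (deg u)%:R) / (2 * r).
  rewrite handshake mulr_suml; apply: eq_bigr => u _.
  by rewrite -[LHS]mulr_natl mulrA.
have r_le (u : G) : r <= Num.sqrt (deg u)%:R by rewrite ler_wsqrtr ?ler_nat.
have cs : #|edges G|%:R ^+ 2 <= GA1 G R * \sum_(A in edges G) b A.
  apply: sqr_card_le_sumM => A /edgesP[u [v [uv ->]]].
    rewrite /b (big_edge +%R) //= -mulrDl divr_gt0 //; last by lra.
    by have := r_le u; have := r_le v; lra.
  rewrite /b !(big_edge +%R) // (big_edge *%R) //= sqrtrM //.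
  have := r_le u; have := r_le v.
  (* Only the denominator is rewritten, so that the whole term is rational in the two roots [p] and
     [q]. *)
  rewrite -[in X in _ / X](sqr_sqrtr (ler0n R (deg u))).
  rewrite -[in X in _ / (_ + X)](sqr_sqrtr (ler0n R (deg v))).
  move: (Num.sqrt (deg u)%:R) (Num.sqrt (deg v)%:R) => p q r_le_q r_le_p.
  have p_gt0 : 0 < p by lra.
  have q_gt0 : 0 < q by lra.
  have -> : 2 * (p * q) / (p ^+ 2 + q ^+ 2) * (p / (2 * r) + q / (2 * r))
      = p * q * (p + q) / (r * (p ^+ 2 + q ^+ 2)).
    by field; rewrite !gt_eqF // addr_gt0 // exprn_gt0.
  rewrite ler_pdivlMr ?mulr_gt0 // ?addr_gt0 ?exprn_gt0 // mul1r.
  (* The two sides of the goal are compared term by term: [p * q * (p + q)] is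
     [q * p ^+ 2 + p * q ^+ 2]. *)
  have rp : r * p ^+ 2 <= q * p ^+ 2 by rewrite ler_wpM2r ?sqr_ge0.
  have rq : r * q ^+ 2 <= p * q ^+ 2 by rewrite ler_wpM2r ?sqr_ge0.
  by lra.
rewrite -natr_sum sum_deg natrM.
move: cs; rewrite sumb mulrA ler_pdivlMr ?mulr_gt0 //.
by move=> cs; rewrite -[X in _ <= X]mulrA; move: (GA1 G R * _) cs => X; lra.
Qed.

End GALowerBound.

(** Positive degrees give every edge a degree sum of at least 2, so truncated subtraction commutes
    with the sum over the edges. *)
Lemma sum_deg_line_graph (G : sgraph) : (forall u : G, 0 < deg u)%N ->
  (\sum_(A : line_graph G) deg A = M1 G - 2 * #|edges G|)%N.
Proof.
move=> deg_gt0; rewrite -sum_deg_edges mulnC -sum_nat_const -sumnB.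
  rewrite [RHS]big_sub.
  by apply: eq_bigr => A _; rewrite deg_line_graph.
move=> A /edgesP[u [v [uv ->]]]; rewrite (big_edge addn) //=.
by have := deg_gt0 u; have := deg_gt0 v; lia.
Qed.

Lemma powR32 (R : realType) (x : R) : 0 <= x -> x `^ (3 / 2) = x * Num.sqrt x.
Proof.
move=> x_ge0; have -> : 3 / 2 = 1 + 2^-1 :> R by field.
by rewrite powRD ?powRr1 // ?powR12_sqrt //; apply/implyP => /eqP; lra.
Qed.

Theorem theorem3p18 (R : realType) (G : sgraph) (m Delta delta : nat)
    (hG : nontrivial G) (hm : m = #|edges G|)
    (hDelta : Delta = max_deg G) (hdelta : delta = min_deg G) :
  GA1 (line_graph G) R >=
    ((2 * delta%:R - 2) `^ (1 / 2) * Delta%:R `^ (3 / 2)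
       * ((M1 G)%:R - 2 * m%:R) ^+ 2) /
    (2 * (Delta%:R - 1) `^ (3 / 2) * chi G (3 / 2 : R)).
Proof.
have deg_gt0 := nontrivial_deg_gt0 hG.
have deg_edge (A : {set G}) : A \in edges G -> (2 <= \sum_(u in A) deg u)%N.
  move=> /edgesP[u [v [uv ->]]]; rewrite (big_edge addn) //=.
  by have := deg_gt0 u; have := deg_gt0 v; lia.
have sumN : (M1 G)%:R - 2 * m%:R = \sum_(A : line_graph G) (deg A)%:R :> R.
  rewrite -natr_sum sum_deg_line_graph // natrB ?natrM ?hm //.
  rewrite -sum_deg_edges mulnC -sum_nat_const; exact: leq_sum.
rewrite {}sumN.
set S := \sum_(A : line_graph G) _; set D := _ * chi G _.
have chi_ge0 : 0 <= chi G (3 / 2 : R).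
  by apply: sumr_ge0 => A _; exact: powR_ge0.
have D_ge0 : 0 <= D by rewrite !mulr_ge0 ?powR_ge0.
(* Division by zero yields 0, so the bound is trivial for a vanishing denominator. *)
have [D0|D_neq0] := eqVneq D 0; first by rewrite D0 invr0 mulr0 GA1_ge0.
have [A0 _|no_edge] := pickP (fun _ : line_graph G => true); last first.
  by rewrite /S big_pred0 // expr0n mulr0 mul0r GA1_ge0.
have [u0 [v0 [uv0 _]]] := edgesP _ (valP A0).
have delta_gt0 : (0 < delta)%N by rewrite hdelta min_deg_gt0.
(* For [delta = 1] the factor with base [2 * delta - 2] is zero, whereas [GA1_lower_bound] needs a
   positive [k]. *)
have [delta1|delta_neq1] := eqVneq delta 1%N.
  by rewrite delta1 mulr1 subrr powR0 ?mul0r ?GA1_ge0 // mul1r invr_eq0 pnatr_eq0.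
have delta_le (u : G) : (delta <= deg u)%N by rewrite hdelta min_deg_le.
have Delta_ge (u : G) : (deg u <= Delta)%N by rewrite hDelta deg_le_max.
have Delta_ge2 : (2 <= Delta)%N by have := delta_le u0; have := Delta_ge u0; lia.
have k_le (A : line_graph G) : (2 * delta - 2 <= deg A)%N.
  rewrite deg_line_graph; have /edgesP[u [v [uv ->]]] := valP A.
  rewrite (big_edge addn) //=.
  by have := delta_le u; have := delta_le v; lia.
have k_gt0 : (0 < 2 * delta - 2)%N by lia.
have := GA1_lower_bound R k_gt0 k_le; rewrite -/S.
have -> : (2 * delta - 2)%:R = 2 * delta%:R - 2 :> R.
  by rewrite natrB ?natrM //; lia.
rewrite mul1r powR12_sqrt; last by rewrite subr_ge0 ler_peMr ?ler1n.
rewrite ler_pdivrMr ?lt_def ?D_neq0 //.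
set T := \sum_(A : line_graph G) _ => bound.
(* Termwise, with s the degree sum of an edge, Delta (s - 2) <= (Delta - 1) s amounts to s <= 2
   Delta; the power 3/2 is monotone. *)
have le_T :
    Delta%:R `^ (3 / 2) * T <= (Delta%:R - 1) `^ (3 / 2) * chi G (3 / 2 : R).
  rewrite /T /chi !mulr_sumr [leRHS]big_sub.
  have Delta1_ge0 : 0 <= Delta%:R - 1 :> R by rewrite subr_ge0 ler1n ltnW.
  apply: ler_sum => A _; rewrite -powR32 // -!powRM ?sumr_ge0 //.
  apply: ge0_ler_powR; rewrite ?nnegrE ?divr_ge0 ?mulr_ge0 ?sumr_ge0 //.
  rewrite deg_line_graph natrB ?(deg_edge _ (valP A)) // natr_sum.
  have : \sum_(u in val A) (deg u)%:R <= 2 * Delta%:R :> R.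
    have /edgesP[u [v [uv ->]]] := valP A; rewrite (big_edge +%R) //=.
    by rewrite -natrD -natrM ler_nat; have := Delta_ge u; have := Delta_ge v; lia.
  by move: (\sum_(u in _) _) (Delta%:R) => x y; lra.
have P_ge0 : 0 <= Delta%:R `^ (3 / 2) :> R by exact: powR_ge0.
have GA_ge0 := GA1_ge0 R (line_graph G).
(* [bound] is scaled by the power of [Delta], which [le_T] then absorbs together with [T]. *)
rewrite mulrAC; apply: le_trans (ler_wpM2r P_ge0 bound) _.
have := ler_wpM2l GA_ge0 le_T; rewrite /D; lra.
Qed.
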